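(* There exists a family of 3-SAT formulas $(F_N)_N$ with $|\mathrm{vars}(F_N)|=\Theta(N)$ such that \[ \beta_2(S(F_N))\ge 2^{cN} \] for some constant $c>0$.
   Context: For a CNF formula $F$ on $n$ variables, the solution complex $S(F)$ is the cubical subcomplex of $\{0,1\}^n$ whose vertices are satisfying assignments and whose $k$-faces are axis-aligned $k$-dimensional subcubes all of whose $2^k$ vertices satisfy $F$. $\beta_2$ denotes the dimension of the second homology group over $\mathbb Z_2$. *)

(* Defs.v *)
From HB Require Import structures.
From mathcomp Require Import all_boot all_algebra.
Set Implicit Arguments.
Unset Strict Implicit.
Unset Printing Implicit Defensive.
Import GRing.Theory.
Local Open Scope ring_scope.

(* The literal (v, true) is v, and (v, false) is its negation. *)
Definition literal (V : finType) : Type := (V * bool)%type.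
Definition clause (V : finType) : Type := seq (literal V).
Definition cnf (V : finType) : Type := seq (clause V).

Definition satisfies (V : finType) (F : cnf V) (a : {ffun V -> bool}) : bool :=
  all (fun C : clause V => has (fun l : literal V => a l.1 == l.2) C) F.

Definition vars (V : finType) (F : cnf V) : {set V} :=
  [set v | has (fun C : clause V => v \in [seq l.1 | l <- C]) F].

(* The strict convention (exactly three literals, on distinct variables); such
   formulas are also 3-SAT when clauses with fewer literals are allowed. *)
Definition is_3sat (V : finType) (F : cnf V) : bool :=
  all (fun C : clause V => (size C == 3)%N && uniq [seq l.1 | l <- C]) F.

(* An axis-aligned subcube of {0,1}^V: coordinate v is free when q v = None,
   and fixed to b when q v = Some b. *)
Definition free_coords (V : finType) (q : {ffun V -> option bool}) : {set V} :=
  [set v | q v == None].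

Definition vertices (V : finType) (q : {ffun V -> option bool}) :
    {set {ffun V -> bool}} :=
  [set a : {ffun V -> bool} | [forall v, (q v == None) || (q v == Some (a v))]].

Definition is_face (V : finType) (F : cnf V) (k : nat)
    (q : {ffun V -> option bool}) : bool :=
  (#|free_coords q| == k)%N && [forall a in vertices q, satisfies F a].

Section CubicalHomology.
Variables (V : finType) (F : cnf V).

Definition face (k : nat) : Type := {q : {ffun V -> option bool} | is_face F k q}.

Definition chain (k : nat) : Type := {ffun face k -> ('F_2)^o}.

(* The boundary of a (k+1)-face is the sum of the k-faces contained in it;
   modulo 2 there are no orientation signs. *)
Definition boundary_fun (k : nat) (c : chain k.+1) : chain k :=
  [ffun p : face k =>
     \sum_(q : face k.+1 | vertices (val p) \subset vertices (val q)) c q].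

Fact boundary_fun_linear k : linear (@boundary_fun k).
Proof.
move=> a u v; apply/ffunP=> p; rewrite !ffunE scaler_sumr -big_split /=.
by apply: eq_bigr => q _; rewrite !ffunE.
Qed.
HB.instance Definition _ k := GRing.isLinear.Build _ _ _ _
  (@boundary_fun k) (@boundary_fun_linear k).

Definition boundary (k : nat) : 'Hom(chain k.+1, chain k) :=
  linfun (@boundary_fun k).

Definition cycles (k : nat) : {vspace chain k} :=
  if k is k'.+1 then lker (boundary k') else fullv.

Definition boundaries (k : nat) : {vspace chain k} := limg (boundary k).

(* The dimension of H_k = cycles k / boundaries k over Z_2; the natural-number
   subtraction does not truncate, by boundaries_sub_cycles below. *)
Definition betti (k : nat) : nat := (\dim (cycles k) - \dim (boundaries k))%N.

Lemma verticesS (p q : {ffun V -> option bool}) :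
  (vertices p \subset vertices q) =
  [forall v, (q v == None) || (q v == p v)].
Proof.
apply/subsetP/forallP=> [sub v|le a]; last first.
  rewrite !inE => /forallP pa; apply/forallP=> v.
  by case/orP: (le v) => /eqP-> //; exact: pa.
have base (b : bool) : p v = Some b \/ p v = None ->
    q v = None \/ q v = Some b.
  move=> pv; pose a := [ffun w => if w == v then b else odflt true (p w)].
  have /sub : a \in vertices p.
    rewrite inE; apply/forallP=> w; rewrite ffunE.
    have [->|_] := eqVneq w v; first by case: pv => ->; rewrite ?eqxx ?orbT.
    by case: (p w) => //= c; rewrite !eqxx orbT.
  by rewrite inE => /forallP/(_ v); rewrite ffunE eqxx => /orP[]/eqP; [left|right].
case pv: (p v) => [b|]; first by case: (base b (or_introl pv)) => ->; rewrite !eqxx ?orbT.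
case: (base true (or_intror pv)) => [->|q1]; first by [].
by case: (base false (or_intror pv)) => q2; [rewrite q2|rewrite q1 in q2].
Qed.

Lemma card_between k (r : face k) (q : face k.+2) :
  vertices (val r) \subset vertices (val q) ->
  #|[pred p : face k.+1 | (vertices (val r) \subset vertices (val p)) &&
                         (vertices (val p) \subset vertices (val q))]| = 2.
Proof.
case: r q => [r rP] [q qP] /= rq.
have /andP[/eqP rk _] := rP; have /andP[/eqP qk /forallP qF] := qP.
pose D := free_coords q :\: free_coords r.
have leE v : (q v == None) || (q v == r v).
  by move: rq; rewrite verticesS => /forallP/(_ v).
have frq : free_coords r \subset free_coords q.
  by apply/subsetP=> v; rewrite !inE => /eqP rv; have := leE v; rewrite rv orbb.
have cD : #|D| = 2.
  by rewrite cardsD (setIidPr frq) qk rk -addn2 addKn.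
pose f x := [ffun z => if z == x then None else r z] : {ffun V -> option bool}.
have ff x : free_coords (f x) = x |: free_coords r.
  by apply/setP=> z; rewrite !inE ffunE; case: (eqVneq z x).
have fP x : x \in D -> is_face F k.+1 (f x) /\ vertices (f x) \subset vertices q.
  rewrite inE => /andP[xr xq].
  have sub : vertices (f x) \subset vertices q.
    rewrite verticesS; apply/forallP=> z; rewrite ffunE; have [->|_] := eqVneq z x => //.
    by move: xq; rewrite inE => ->.
  split=> //; rewrite /is_face ff cardsU1 xr rk eqxx /=.
  by apply/forallP=> a; apply/implyP=> /(subsetP sub) aq; exact: (implyP (qF a)).
have finj : {in D &, injective f}.
  move=> x y; rewrite !inE => /andP[xr _] _ /ffunP/(_ x); rewrite !ffunE eqxx.
  by case: (eqVneq x y) => // _ /esym/eqP; rewrite (negPf xr).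
rewrite -cD -(card_in_imset finj) -(card_imset _ val_inj).
apply: eq_card => p; apply/imsetP/imsetP.
  case=> [[s sP]]; rewrite inE /= => /andP[rs sq] ->.
  have /andP[/eqP sk _] := sP.
  have leS v : (s v == None) || (s v == r v).
    by move: rs; rewrite verticesS => /forallP/(_ v).
  have leQ v : (q v == None) || (q v == s v).
    by move: sq; rewrite verticesS => /forallP/(_ v).
  have frs : free_coords r \subset free_coords s.
    by apply/subsetP=> v; rewrite !inE => /eqP rv; have := leS v; rewrite rv orbb.
  have fsq : free_coords s \subset free_coords q.
    by apply/subsetP=> v; rewrite !inE => /eqP rv; have := leQ v; rewrite rv orbb.
  have /eqP/cards1P[x xE] : #|free_coords s :\: free_coords r| = 1.
    by rewrite cardsD (setIidPr frs) sk rk subSnn.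
  have : x \in free_coords s :\: free_coords r by rewrite xE inE.
  rewrite inE => /andP[xr xs].
  exists x; first by rewrite inE xr (subsetP fsq).
  apply/ffunP=> z; rewrite ffunE; have [->|nzx] := eqVneq z x.
    by move: xs; rewrite inE => /eqP.
  case/orP: (leS z) => /eqP // sz; rewrite sz.
  have : z \notin free_coords s :\: free_coords r by rewrite xE inE.
  by rewrite !inE sz eqxx andbT negbK => /eqP.
case=> x xD ->; have [fxF fxq] := fP x xD.
exists (exist _ (f x) fxF) => //; rewrite inE /= fxq andbT.
by rewrite verticesS; apply/forallP=> z; rewrite ffunE;
  case: (eqVneq z x) => //= _; rewrite eqxx orbT.
Qed.

Lemma boundary_boundary k (c : chain k.+2) : boundary k (boundary k.+1 c) = 0.
Proof.
rewrite !lfunE /=; apply/ffunP=> r; rewrite !ffunE.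
under eq_bigr do rewrite ffunE.
rewrite (exchange_big_dep (fun q : face k.+2 =>
  vertices (val r) \subset vertices (val q))) /=; last first.
  by move=> p q; exact: subset_trans.
apply: big1 => q rq; rewrite sumr_const (card_between rq).
have two0 : 2%:R = 0 :> 'F_2 by exact: val_inj.
by rewrite -[LHS](mulr_natr (c q : 'F_2)) two0 mulr0.
Qed.

Lemma boundaries_sub_cycles k : (boundaries k <= cycles k)%VS.
Proof.
case: k => [|k]; first exact: subvf.
apply/subvP=> _ /memv_imgP[c _ ->].
by rewrite memv_ker boundary_boundary.
Qed.

End CubicalHomology.

(* Main.v *)
From HB Require Import structures.
Require Import Defs.
From mathcomp Require Import all_boot all_order all_algebra.
From mathcomp Require Import all_classical all_reals all_analysis.
Set Implicit Arguments.
Unset Strict Implicit.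
Unset Printing Implicit Defensive.
Import Order.TTheory GRing.Theory Num.Theory.
Import numFieldNormedType.Exports.
Local Open Scope ring_scope.

(** The formula splits into blocks of three variables.  A clause on the three
    variables of a block excludes exactly one of its 8 assignments, so that
    each of [N] blocks can be forced to be constant (two isolated points), and
    each of two further blocks to be nonconstant (a hexagonal cycle).  The
    solution complex is then a disjoint union of [2^N] tori.  It has no
    3-faces, and every edge lies in exactly two squares; hence the sum of all
    the squares of a component is a 2-cycle, and these [2^N] cycles are linearly
    independent modulo the zero space of boundaries. *)

(** * The formula and the faces of its solution complex *)

(* [inl] indexes the constant blocks, [inr] the nonconstant ones. *)
Definition block_index (N : nat) : finType := ('I_N + bool)%type.
Definition block_var (N : nat) : finType := (block_index N * 'I_3)%type.

Definition block_clause (N : nat) (b : block_index N) (s : bool * bool * bool) :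
    clause (block_var N) :=
  [:: ((b, 0), s.1.1); ((b, 1), s.1.2); ((b, 2%:R), s.2)].

(** A clause is violated only by the complement of its sign triple. Both lists are closed under
    complement, so each is also the list of excluded assignments. *)
Definition block_signs (N : nat) (b : block_index N) : seq (bool * bool * bool) :=
  match b with
  | inl _ => [:: (true, true, false); (true, false, true); (false, true, true);
                 (true, false, false); (false, true, false); (false, false, true)]
  | inr _ => [:: (true, true, true); (false, false, false)]
  end.

Definition tori_cnf (N : nat) : cnf (block_var N) :=
  [seq block_clause b s | b <- enum (block_index N), s <- block_signs b].

(* The faces of the solution complex of a block: a nonconstant block must keep
   both values among its fixed coordinates, hence has at most one free one. *)
Definition block_cell (N : nat) (b : block_index N) (t : 'I_3 -> option bool) : bool :=
  match b with
  | inl _ => [&& t 0 != None, t 1 == t 0 & t 2%:R == t 0]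
  | inr _ => (Some true \in [:: t 0; t 1; t 2%:R]) &&
             (Some false \in [:: t 0; t 1; t 2%:R])
  end.

Lemma ord3_ind (P : 'I_3 -> Prop) : P 0 -> P 1 -> P 2%:R -> forall j, P j.
Proof.
move=> P0 P1 P2 [[|[|[|//]]] lt_j].
- by have -> : Ordinal lt_j = 0 by apply: val_inj.
- by have -> : Ordinal lt_j = 1 by apply: val_inj.
- by have -> : Ordinal lt_j = 2%:R by apply: val_inj.
Qed.

Lemma eq_block_cell N (b : block_index N) (t u : 'I_3 -> option bool) :
  t =1 u -> block_cell b t = block_cell b u.
Proof. by move=> tu; rewrite /block_cell !tu. Qed.

Lemma tori_cnf_3sat N : is_3sat (tori_cnf N).
Proof.
apply/allP=> C /allpairsPdep[b [s [_ _ ->]]].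
by rewrite /= !inE !xpair_eqE !eqxx.
Qed.

Lemma vars_tori_cnf N (v : block_var N) : v \in vars (tori_cnf N).
Proof.
case: v => b j; rewrite inE; apply/hasP.
(* Every clause of a block mentions all its variables, so one clause suffices; the lists are
   nonempty and the default of [head] is never reached. *)
have bs : head (true, true, true) (block_signs b) \in block_signs b.
  by case: b => ?; rewrite /= in_cons eqxx.
exists (block_clause b (head (true, true, true) (block_signs b))).
  by apply/allpairsPdep; exists b, (head (true, true, true) (block_signs b)); rewrite mem_enum.
by elim/ord3_ind: j; rewrite /= !inE eqxx ?orbT.
Qed.

Lemma satisfies_tori_cnf N (a : {ffun block_var N -> bool}) :
  satisfies (tori_cnf N) a = [forall b, block_cell b (fun j => Some (a (b, j)))].
Proof.
have E b : all (fun s => has (fun l : literal _ => a l.1 == l.2) (block_clause b s))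
    (block_signs b) = block_cell b (fun j => Some (a (b, j))).
  case: b => b /=; case: (a (_, 0)); case: (a (_, 1)); case: (a (_, 2%:R)) => //=.
apply/allP/forallP => [sat b|ok C /allpairsPdep[b [s [_ sb ->]]]].
  rewrite -E; apply/allP=> s sb; apply: sat; apply/allpairsPdep.
  by exists b, s; rewrite mem_enum.
by have := ok b; rewrite -E => /allP; exact.
Qed.

(* Completing the free coordinates by true, by false and by one nonconstant
   pattern is enough to detect every subcube that leaves the complex. *)
Lemma is_face_tori_cnf N k (q : {ffun block_var N -> option bool}) :
  is_face (tori_cnf N) k q =
  (#|free_coords q| == k) && [forall b, block_cell b (fun j => q (b, j))].
Proof.
rewrite /is_face; congr (_ && _); apply/forall_inP/forallP => [sat b|ok a].
  have cell (h : 'I_3 -> bool) :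
      block_cell b (fun j => Some (odflt (h j) (q (b, j)))).
    pose a := [ffun v : block_var N => odflt (h v.2) (q v)].
    have /sat : a \in vertices q.
      rewrite inE; apply/forallP=> v; rewrite ffunE.
      by case: (q v) => //= x; rewrite eqxx orbT.
    rewrite satisfies_tori_cnf => /forallP/(_ b).
    rewrite (@eq_block_cell _ _ _ (fun j => Some (odflt (h j) (q (b, j))))) //.
    by move=> j; rewrite ffunE.
  move: (cell (fun=> true)) (cell (fun=> false)) (cell (fun j => j == 0)).
  rewrite /block_cell; case: b {cell} => b;
  by case: (q (_, 0)) => [[]|]; case: (q (_, 1)) => [[]|];
     case: (q (_, 2%:R)) => [[]|].
rewrite inE satisfies_tori_cnf => /forallP aq; apply/forallP=> b.
move: (ok b) (aq (b, 0)) (aq (b, 1)) (aq (b, 2%:R)).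
rewrite /block_cell; case: b => b;
by case: (q (_, 0)) => [[]|]; case: (q (_, 1)) => [[]|];
   case: (q (_, 2%:R)) => [[]|] //=; case: (a (_, 0)); case: (a (_, 1));
   case: (a (_, 2%:R)).
Qed.

(** * Free coordinates of a face *)

Lemma block_cell_free N (b : block_index N) t j :
  block_cell b t -> t j = None -> exists c, b = inr c.
Proof.
case: b => [i|c _ _]; last by exists c.
rewrite /block_cell => /and3P[t0 /eqP t1 /eqP t2] tj; case/negP: t0.
by elim/ord3_ind: j tj => <-; rewrite ?t1 ?t2.
Qed.

(** A free coordinate forces a nonconstant block, where [true] and [false] already occupy two of the
    three places. *)
Lemma block_cell_free_inj N (b : block_index N) t j k :
  block_cell b t -> t j = None -> t k = None -> j = k.
Proof.
move=> bt tj tk; have [c Eb] := block_cell_free bt tj; move: bt; rewrite Eb /= !inE.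
by elim/ord3_ind: j tj => ->; elim/ord3_ind: k tk => // ->;
  case: (t _) => [[]|].
Qed.

Definition free_at (I : eqType) (t : I -> option bool) (j : I) : I -> option bool :=
  fun k => if k == j then None else t k.

(* The two coordinates that can be freed are those carrying the majority value. *)
Lemma block_cell_free_at N (c : bool) t :
  block_cell (inr c : block_index N) t -> (forall j, t j != None) ->
  exists j1 j2, j1 != j2 /\
    forall j, block_cell (inr c : block_index N) (free_at t j) = (j \in [:: j1; j2]).
Proof.
move=> + tN; rewrite /block_cell /free_at.
move: (tN 0) (tN 1) (tN 2%:R).
case: (t 0) => [[]|]; case: (t 1) => [[]|]; case: (t 2%:R) => [[]|] // _ _ _ _.
- by exists 0, 1; split=> //; elim/ord3_ind.
- by exists 0, 2%:R; split=> //; elim/ord3_ind.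
- by exists 1, 2%:R; split=> //; elim/ord3_ind.
- by exists 1, 2%:R; split=> //; elim/ord3_ind.
- by exists 0, 2%:R; split=> //; elim/ord3_ind.
- by exists 0, 1; split=> //; elim/ord3_ind.
Qed.

Lemma card_free_tori_cnf N (q : {ffun block_var N -> option bool}) :
  [forall b, block_cell b (fun j => q (b, j))] -> (#|free_coords q| <= 2)%N.
Proof.
(* On free coordinates [f] tells the two nonconstant blocks apart, and each has at most one, so [f]
   injects them into [bool]. *)
move=> /forallP qP; pose f (v : block_var N) := v.1 == inr true.
have <- : #|f @: free_coords q| = #|free_coords q|.
  apply: card_in_imset => -[b j] [b' j']; rewrite !inE /f => /eqP qj /eqP qj' /=.
  have [c Eb] := block_cell_free (qP b) qj; have [c' Eb'] := block_cell_free (qP b') qj'.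
  have {f} -> : (b == inr true) = c by rewrite Eb; case: (c).
  have -> : (b' == inr true) = c' by rewrite Eb'; case: (c').
  move=> cc'; rewrite cc' in Eb; rewrite -Eb' in Eb; rewrite -{}Eb in qj' *.
  by rewrite (block_cell_free_inj (qP b) qj qj').
by rewrite -card_bool max_card.
Qed.

(** * Absence of 3-faces, and the squares around an edge *)

Lemma boundaries2_tori_cnf N : boundaries (tori_cnf N) 2 = 0%VS.
Proof.
apply/eqP; rewrite -subv0; apply/subvP=> _ /memv_imgP[c _ ->].
suff -> : c = 0 by rewrite linear0 mem0v.
apply/ffunP=> -[q qP]; exfalso; move: (qP); rewrite is_face_tori_cnf => /andP[/eqP q3 ok].
by have := card_free_tori_cnf ok; rewrite q3.
Qed.

(** An edge of the torus is an edge of one hexagon times a vertex of the other; the squares on it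
    come from the two hexagon edges at that vertex. *)
Lemma card_cofaces_tori_cnf N (p : face (tori_cnf N) 1) :
  #|[pred q : face (tori_cnf N) 2 | vertices (val p) \subset vertices (val q)]| = 2.
Proof.
case: p => p pP /=; move: (pP); rewrite is_face_tori_cnf => /andP[/eqP p1 /forallP pok].
have /cards1P[[b0 j0] pE] : #|free_coords p| == 1%N by rewrite p1.
have pN v : (p v == None) = (v == (b0, j0)).
  by move/finset.setP: pE => /(_ v); rewrite !inE.
have p0 : p (b0, j0) = None by apply/eqP; rewrite pN.
have [c Eb0] := block_cell_free (pok b0) p0.
have [|j1 [j2 [j12 jP]]] := block_cell_free_at (pok (inr (~~ c))).
  by move=> j; rewrite pN Eb0 xpair_eqE; case: (c).
pose f v := [ffun w => free_at p v w] : {ffun block_var N -> option bool}.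
pose D := [set (inr (~~ c), j1); (inr (~~ c), j2)] : {set block_var N}.
have cD : #|D| = 2 by rewrite cards2 xpair_eqE eqxx j12.
(* Freeing one more coordinate stays in the complex only in the other hexagon: constant blocks admit
   no free coordinate, and [b0] already has its only one. *)
have fok v : p v != None ->
    [forall b, block_cell b (fun j => f v (b, j))] = (v \in D).
  case: v => b j pv; apply/forallP/idP => [/(_ b) ok|vD b'].
    have fj : f (b, j) (b, j) = None by rewrite ffunE /free_at eqxx.
    have [c' Eb] := block_cell_free ok fj.
    have [Ec|Ec] := eqVneq c' c.
      have {Eb} Eb : b = b0 by rewrite Eb Ec Eb0.
      have fj0 : f (b, j) (b, j0) = None.
        by rewrite ffunE /free_at [in p _]Eb p0; case: ifP.
      by move: pv; rewrite (block_cell_free_inj ok fj fj0) Eb p0.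
    have {}Ec : c' = ~~ c by case: (c') (c) Ec => -[].
    rewrite Ec in Eb; subst b.
    have -> : ((inr (~~ c), j) \in D) = (j \in [:: j1; j2]).
      by rewrite !inE !xpair_eqE eqxx.
    rewrite -jP; apply: etrans ok; apply: eq_block_cell => k.
    by rewrite ffunE /free_at xpair_eqE eqxx.
  have Eb : b = inr (~~ c) by move: vD; rewrite !inE => /orP[] /eqP[].
  have [->|nb] := eqVneq b' b.
    rewrite Eb (@eq_block_cell _ _ _ (free_at (fun k => p (inr (~~ c), k)) j)).
      by rewrite jP !inE; move: vD; rewrite Eb !inE !xpair_eqE eqxx.
    by move=> k; rewrite ffunE /free_at xpair_eqE eqxx.
  rewrite (@eq_block_cell _ _ _ (fun k => p (b', k))) //.
  by move=> k; rewrite ffunE /free_at xpair_eqE (negPf nb).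
have ff v : free_coords (f v) = v |: free_coords p.
  by apply/finset.setP=> z; rewrite !inE ffunE /free_at; case: (eqVneq z v).
have DN v : v \in D -> p v != None.
  by rewrite pN Eb0 !inE => /orP[]/eqP->; rewrite xpair_eqE; case: (c).
have fP v : v \in D -> is_face (tori_cnf N) 2 (f v).
  move=> vD; rewrite is_face_tori_cnf (fok _ (DN _ vD)) vD ff cardsU1 p1 inE.
  by rewrite DN.
have pf v : vertices p \subset vertices (f v).
  rewrite verticesS; apply/forallP=> z; rewrite ffunE /free_at.
  by case: (eqVneq z v) => //= _; rewrite eqxx orbT.
have finj : {in D &, injective f}.
  move=> v w /DN pv _ /ffunP/(_ v); rewrite !ffunE /free_at eqxx.
  by case: (eqVneq v w) => // _ /esym/eqP; rewrite (negPf pv).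
rewrite -cD -(card_in_imset finj) -(card_imset _ val_inj).
apply: eq_card => q; apply/imsetP/imsetP => -[]; last first.
  by move=> v vD ->; exists (exist _ (f v) (fP v vD)) => //; rewrite inE /= pf.
case=> s sP; rewrite inE /= => ps ->; move: (sP).
rewrite is_face_tori_cnf => /andP[/eqP s2 sok].
have leS z : (s z == None) || (s z == p z) by move: ps; rewrite verticesS => /forallP/(_ z).
have fps : free_coords p \subset free_coords s.
  by apply/fintype.subsetP=> z; rewrite !inE => /eqP pz; have := leS z; rewrite pz orbb.
(* A square on [p] frees exactly one further coordinate [x], hence equals [f x]. *)
have /eqP/cards1P[x xE] : #|free_coords s :\: free_coords p| = 1%N.
  by rewrite cardsD (finset.setIidPr fps) s2 p1.
have : x \in free_coords s :\: free_coords p by rewrite xE inE.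
rewrite !inE => /andP[px /eqP sx].
have Es : s = f x.
  apply/ffunP=> z; rewrite ffunE /free_at; have [->//|nzx] := eqVneq z x.
  case/orP: (leS z) => /eqP // sz; rewrite sz.
  have : z \notin free_coords s :\: free_coords p by rewrite xE inE.
  by rewrite !inE sz eqxx andbT negbK => /eqP.
by exists x => //; rewrite -fok // -Es.
Qed.

(** * Independent 2-cycles, one for each torus *)

Definition bits (N : nat) : finType := {ffun 'I_N -> bool}.

(** On a face, coordinate 0 of a constant block is fixed and carries the value of the whole block;
    these values label the torus. *)
Definition component (N : nat) (q : {ffun block_var N -> option bool}) : bits N :=
  [ffun i => q (inl i, 0) == Some true].

(** The indicator of a label is sent to the sum of all squares of its torus. *)
Definition torus_sum_fun N (g : {ffun bits N -> ('F_2)^o}) : chain (tori_cnf N) 2 :=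
  [ffun q => g (component (val q))].

Fact torus_sum_linear N : linear (@torus_sum_fun N).
Proof. by move=> a u v; apply/ffunP=> q; rewrite !ffunE. Qed.
HB.instance Definition _ N := GRing.isLinear.Build _ _ _ _
  (@torus_sum_fun N) (@torus_sum_linear N).

Definition torus_sum N : 'Hom({ffun bits N -> ('F_2)^o}, chain (tori_cnf N) 2) :=
  linfun (@torus_sum_fun N).

Lemma component_subset N k l (p : face (tori_cnf N) k) (q : face (tori_cnf N) l) :
  vertices (val p) \subset vertices (val q) ->
  component (val q) = component (val p).
Proof.
case: p q => p pP [q qP] /=; rewrite verticesS => /forallP pq.
move: qP; rewrite is_face_tori_cnf => /andP[_ /forallP qok].
apply/ffunP=> i; rewrite !ffunE; case/orP: (pq (inl i, 0)) => /eqP qi; last by rewrite qi.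
by have [] := block_cell_free (qok (inl i)) qi.
Qed.

(** The two squares on an edge lie in the same torus, so their equal coefficients cancel modulo
    2. *)
Lemma torus_sum_cycle N g : torus_sum N g \in cycles (tori_cnf N) 2.
Proof.
rewrite memv_ker !lfunE /=; apply/eqP/ffunP=> p; rewrite !ffunE.
under eq_bigr => q pq do rewrite ffunE (component_subset pq).
rewrite sumr_const card_cofaces_tori_cnf.
have two0 : 2%:R = 0 :> 'F_2 by exact: val_inj.
by rewrite -[LHS](mulr_natr (g _ : 'F_2)) two0 mulr0.
Qed.

Lemma lker_torus_sum N : lker (torus_sum N) = 0%VS.
Proof.
apply/eqP; rewrite -subv0; apply/subvP=> g.
rewrite memv_ker lfunE memv0 /= => /eqP/ffunP g0; apply/eqP/ffunP=> a.
(* The pattern (free, [true], [false]) is a hexagon edge; used in both hexagons it gives a square in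
   the torus labelled [a], whose coefficient is [g a]. *)
pose hex (j : 'I_3) := if j == 0 then None else Some (j == 1).
pose q : {ffun block_var N -> option bool} :=
  [ffun v => if v.1 is inl i then Some (a i) else hex v.2].
have qP : is_face (tori_cnf N) 2 q.
  rewrite is_face_tori_cnf; apply/andP; split.
    suff -> : free_coords q = [set (inr true, 0); (inr false, 0)].
      by rewrite cards2 xpair_eqE.
    apply/finset.setP=> -[b j]; rewrite !inE ffunE !xpair_eqE.
    by case: b => [//|[]] /=; elim/ord3_ind: j.
  apply/forallP=> -[i|c]; rewrite /block_cell !ffunE //=.
  by rewrite !eqxx.
have := g0 (exist _ q qP); rewrite !ffunE /= => <-; congr (g _).
by apply/ffunP=> i; rewrite !ffunE /=; case: (a i).
Qed.

Lemma betti2_tori_cnf N : (2 ^ N <= betti (tori_cnf N) 2)%N.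
Proof.
rewrite /betti boundaries2_tori_cnf dimv0 subn0.
have <- : \dim (limg (torus_sum N)) = (2 ^ N)%N.
  rewrite limg_dim_eq ?lker_torus_sum ?capv0 // dimvf.
  by rewrite /dim /= muln1 card_ffun card_bool card_ord.
by apply/dimvS/subvP=> _ /memv_imgP[g _ ->]; exact: torus_sum_cycle.
Qed.

(** * Variable count and asymptotics *)

Lemma card_vars_tori_cnf N : #|vars (tori_cnf N)| = (N * 3 + 6)%N.
Proof.
have -> : vars (tori_cnf N) = [set: block_var N].
  by apply/finset.setP=> v; rewrite vars_tori_cnf inE.
by rewrite cardsT card_prod card_sum card_bool !card_ord mulnDl.
Qed.

Local Open Scope classical_set_scope.

Theorem mainTheorem5 (R : realType) :
  exists (V : nat -> finType) (F : forall N : nat, cnf (V N)),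
    [/\ forall N : nat, is_3sat (F N),
        forall (N : nat) (v : V N), v \in vars (F N),
        (fun N : nat => #|vars (F N)|%:R : R^o) \is 'Theta_\oo
          (fun N : nat => N%:R : R^o)
      & exists2 c : R, 0 < c &
          forall N : nat, 2 `^ (c * N%:R) <= (betti (F N) 2)%:R].
Proof.
exists block_var, tori_cnf; split.
- exact: tori_cnf_3sat.
- exact: vars_tori_cnf.
(* The constants come from [N <= 3 * N + 6 <= 9 * N], where the upper bound needs [N >= 1]. *)
- rewrite qualifE; apply/asboolP; exists (1, 9) => /=; first by rewrite ltr01 ltr0n.
  exists 1%N => // N /= N1; rewrite card_vars_tori_cnf !normr_nat mul1r -natrM !ler_nat.
  split; first by rewrite (leq_trans (leq_pmulr N (isT : 0 < 3)%N)) ?leq_addr.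
  by rewrite -[9%N]/(3 + 6)%N mulnDl (mulnC N) leq_add2l leq_pmulr.
- exists 1 => // N.
  by rewrite mul1r powR_mulrn // -natrX ler_nat betti2_tori_cnf.
Qed.
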